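(* Let $q\geqslant2$ be an even integer, $n\geqslant4$, and let $f:\mathbb{F}_2^n\to\mathbb{Z}_q$ be a self-dual generalized bent function. For $a,b\in\mathbb{F}_2$ let $F^{ab}\in\mathbb{C}^{2^{n-2}}$ be the vector $(\omega^{f(a,b,x)})_{x\in\mathbb{F}_2^{n-2}}$ (with a fixed ordering of $\mathbb{F}_2^{n-2}$), so that the sign function of $f$ is $(F^{00},F^{01},F^{10},F^{11})$. Then $$\langle F^{00},F^{01}\rangle+\langle F^{10},F^{11}\rangle=0,\qquad \langle F^{00},F^{10}\rangle+\langle F^{01},F^{11}\rangle=0,$$ where $\langle u,v\rangle=\sum_j u_j\overline{v_j}$ is the Hermitian inner product on $\mathbb{C}^{2^{n-2}}$.
   Context: $\omega=e^{2\pi i/q}$. $H_f(y)=\sum_{x\in\mathbb{F}_2^n}\omega^{f(x)}(-1)^{\langle x,y\rangle}$ with $\langle x,y\rangle=\bigoplus_ix_iy_i$. $f$ is self-dual generalized bent if $H_f(y)=2^{n/2}\omega^{f(y)}$ for all $y\in\mathbb{F}_2^n$. *)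

(* Defs.v *)
From HB Require Import structures.
From mathcomp Require Import all_boot all_order all_algebra.
From mathcomp Require Import all_classical all_reals all_analysis.
From mathcomp Require Import complex.

Set Implicit Arguments.
Unset Strict Implicit.
Unset Printing Implicit Defensive.

Import Order.TTheory GRing.Theory Num.Theory.

Local Open Scope ring_scope.
Local Open Scope complex_scope.

(* e^(2 pi i / q), by Euler's formula *)
Definition omega (R : realType) (q : nat) : R[i] :=
  cos (2 * pi / q%:R) +i* sin (2 * pi / q%:R).

Definition dotF2 (n : nat) (x y : 'rV['F_2]_n) : 'F_2 :=
  \sum_(i < n) x 0 i * y 0 i.

(* For 1 < q, the exponent is the representative of f x in {0, ..., q - 1}. *)
Definition sign_fun (R : realType) (q n : nat) (f : 'rV['F_2]_n -> 'Z_q)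
  (x : 'rV['F_2]_n) : R[i] := omega R q ^+ nat_of_ord (f x).

Definition walsh (R : realType) (q n : nat) (f : 'rV['F_2]_n -> 'Z_q)
  (y : 'rV['F_2]_n) : R[i] :=
  \sum_(x : 'rV['F_2]_n) sign_fun R f x * (-1) ^+ nat_of_ord (dotF2 x y).

Definition self_dual_gbent (R : realType) (q n : nat)
  (f : 'rV['F_2]_n -> 'Z_q) : Prop :=
  forall y : 'rV['F_2]_n,
    walsh R f y = (powR 2 (n%:R / 2))%:C * sign_fun R f y.

(* The vector (a, b, x) of F_2^n; meaningful for 2 <= n. *)
Definition prepend2 (n : nat) (a b : 'F_2) (x : 'rV['F_2]_(n - 2)) :
  'rV['F_2]_n :=
  \row_(i < n) [:: a, b & [seq x 0 j | j <- enum 'I_(n - 2)]]`_i.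

(* The block F^{ab}, for the ordering e 0, e 1, ... of F_2^(n-2). *)
Definition sign_block (R : realType) (q n : nat) (f : 'rV['F_2]_n -> 'Z_q)
  (e : 'I_(2 ^ (n - 2)) -> 'rV['F_2]_(n - 2)) (a b : 'F_2) :
  'rV[R[i]]_(2 ^ (n - 2)) :=
  \row_(j < 2 ^ (n - 2)) sign_fun R f (prepend2 a b (e j)).

(* Main.v *)
(* Write W for the Walsh transform, s for the sign function of f, so that
   W s = c s with c real, and let T and M be translation by a unit vector u and
   multiplication by (-1)^<u, x>.  Then W T = M W, W M = T W, T M = - M T, and
   W is self-adjoint.  Hence c <s, T s> = <s, W T s> = c <s, M s>, which is 0
   because |s| = 1, and
   c <M s, T s> = <M s, W M s> = <W M s, M s> = c <T s, M s>
   = - c <M s, T s>, which is 0 as well.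
   The two sums claimed to vanish are (<s, T s> + <M s, T s>) / 2, for the unit
   vector u along the second and the first coordinate respectively. *)
Require Import Defs.
From mathcomp Require Import all_boot all_order all_algebra.
From mathcomp Require Import all_classical all_reals all_analysis.
From mathcomp Require Import complex.
From mathcomp Require Import ring.

Set Implicit Arguments.
Unset Strict Implicit.
Unset Printing Implicit Defensive.

Import Order.TTheory GRing.Theory Num.Theory.

Local Open Scope ring_scope.

Lemma F2P (a : 'F_2) : a = 0 \/ a = 1.
Proof. by case: a => [[|[|k]] // ka]; [left|right]; apply/val_inj. Qed.

Lemma F2_addrr (a : 'F_2) : a + a = 0.
Proof. by case: (F2P a) => ->; apply/val_inj. Qed.

Lemma mx_F2_addrr m n (x : 'M['F_2]_(m, n)) : x + x = 0.
Proof. by apply/matrixP => i j; rewrite !mxE F2_addrr. Qed.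

Lemma rV_F2_addrK n (u : 'rV['F_2]_n) : involutive (+%R^~ u).
Proof. by move=> x; rewrite /= -addrA mx_F2_addrr addr0. Qed.

Lemma dotF2C n (x y : 'rV['F_2]_n) : dotF2 x y = dotF2 y x.
Proof. by apply: eq_bigr => i _; rewrite mulrC. Qed.

Lemma dotF2Dr n (x y z : 'rV['F_2]_n) :
  dotF2 x (y + z) = dotF2 x y + dotF2 x z.
Proof. by rewrite -big_split; apply: eq_bigr => i _; rewrite mxE mulrDr. Qed.

Lemma dotF2_delta n (i : 'I_n) (x : 'rV['F_2]_n) :
  dotF2 (delta_mx 0 i) x = x 0 i.
Proof.
rewrite /dotF2 (bigD1 i) //= big1 => [|j /negbTE ji]; rewrite !mxE !eqxx.
  by rewrite mul1r addr0.
by rewrite ji mul0r.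
Qed.

Lemma eq_opp0 (C : numDomainType) (z : C) : z = - z -> z = 0.
Proof. by move/eqP; rewrite -addr_eq0 -mulr2n mulrn_eq0 => /eqP. Qed.

(** * The Walsh transform under translation and modulation *)

Section HermitianSums.

Variables (C : numClosedFieldType) (n : nat).
Implicit Types (x y u : 'rV['F_2]_n) (s g h : 'rV['F_2]_n -> C).

Let chi x y : C := (-1) ^+ nat_of_ord (dotF2 x y).
Let W g y : C := \sum_x g x * chi x y.

Lemma chiC x y : chi x y = chi y x.
Proof. by rewrite /chi dotF2C. Qed.

(** The exponent is only a representative modulo 2, so the rule is checked on the four pairs of
    values. *)
Lemma chiDr x y u : chi x (y + u) = chi x y * chi x u.
Proof.
rewrite /chi dotF2Dr.
by case: (F2P (dotF2 x y)) => ->; case: (F2P (dotF2 x u)) => -> /=;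
  rewrite ?(expr0, expr1, mulr1, mul1r, mulrNN).
Qed.

Lemma conj_chi x y : (chi x y)^* = chi x y.
Proof. by rewrite /chi rmorph_sign. Qed.

(** The kernel [chi] is real and symmetric, so exchanging the two sums suffices. *)
Lemma W_selfadjoint g h : \sum_y W g y * (h y)^* = \sum_x g x * (W h x)^*.
Proof.
under eq_bigr do rewrite mulr_suml.
rewrite exchange_big; apply: eq_bigr => x _ /=.
rewrite rmorph_sum mulr_sumr; apply: eq_bigr => y _ /=.
by rewrite rmorphM /= conj_chi chiC; ring.
Qed.

Lemma W_translate g u y : W (fun x => g (x + u)) y = chi u y * W g y.
Proof.
rewrite /W (reindex_inj (inv_inj (@rV_F2_addrK n u))) mulr_sumr.
by apply: eq_bigr => x _; rewrite rV_F2_addrK !(chiC _ y) chiDr; ring.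
Qed.

Lemma W_modulate g u y : W (fun x => chi u x * g x) y = W g (y + u).
Proof.
by apply: eq_bigr => x _; rewrite chiDr (chiC u); ring.
Qed.

(** * Correlations of a unimodular eigenvector with its translates *)

Section Eigenvector.

Variables (s : 'rV['F_2]_n -> C) (c : C) (u : 'rV['F_2]_n).
Hypotheses (c0 : c != 0) (c_real : c^* = c).
Hypothesis s_unit : forall x, s x * (s x)^* = 1.
Hypothesis Ws : forall y, W s y = c * s y.
Hypothesis uu : dotF2 u u = 1.

Lemma chi_translate x : chi u (x + u) = - chi u x.
Proof. by rewrite chiDr {2}/chi uu expr1 mulrN1. Qed.

Lemma sum_chi : \sum_x chi u x = 0.
Proof.
apply: eq_opp0; rewrite {1}(reindex_inj (inv_inj (@rV_F2_addrK n u))) /=.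
by rewrite -sumrN; apply: eq_bigr => x _; rewrite chi_translate.
Qed.

Lemma autocorrelation_eq0 : \sum_x s x * (s (x + u))^* = 0.
Proof.
apply: (mulfI c0); rewrite mulr0 mulr_sumr.
under eq_bigr do rewrite mulrA -Ws.
rewrite (W_selfadjoint s (fun x => s (x + u))).
transitivity (c * \sum_x chi u x); last by rewrite sum_chi mulr0.
rewrite mulr_sumr; apply: eq_bigr => x _.
rewrite W_translate Ws !rmorphM /= c_real conj_chi.
by rewrite -[RHS]mulr1 -(s_unit x); ring.
Qed.

(* Translation and modulation by u anticommute because u.u = 1. *)
Lemma twisted_autocorrelation_eq0 : \sum_x chi u x * s x * (s (x + u))^* = 0.
Proof.
apply: eq_opp0; apply: (mulfI c0); rewrite mulr_sumr.
(* The value c s(x + u) is the transform of the modulated function at x, which makes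
   self-adjointness applicable. *)
transitivity (\sum_x chi u x * s x * (W (fun x => chi u x * s x) x)^*).
  apply: eq_bigr => x _; rewrite W_modulate Ws rmorphM /= c_real; ring.
rewrite -(W_selfadjoint (fun x => chi u x * s x) (fun x => chi u x * s x)).
(* After the shift by [u] the transform becomes W s x = c s x, and [chi_translate] supplies the
   minus sign. *)
rewrite (reindex_inj (inv_inj (@rV_F2_addrK n u))) -sumrN mulr_sumr.
apply: eq_bigr => x _; rewrite W_modulate rV_F2_addrK chi_translate Ws.
by rewrite rmorphM rmorphN /= conj_chi; ring.
Qed.

(** The weight 1 + chi u x is 2 on the hyperplane u.x = 0 and 0 off it, so twice this sum is the sum
    of the two preceding ones. *)
Lemma half_autocorrelation_eq0 :
  \sum_(x | dotF2 u x == 0) s x * (s (x + u))^* = 0.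
Proof.
apply: eq_opp0; apply/eqP; rewrite -subr_eq0 opprK; apply/eqP.
rewrite -[RHS](addr0 0) -[X in _ = X + _]autocorrelation_eq0.
rewrite -[X in _ = _ + X]twisted_autocorrelation_eq0.
rewrite -!big_split /= big_mkcond [RHS]big_mkcond; apply: eq_bigr => x _ /=.
rewrite /chi; case: (F2P (dotF2 u x)) => -> /=; first by rewrite expr0; ring.
by rewrite expr1; ring.
Qed.

End Eigenvector.

End HermitianSums.

Lemma omega_unit (R : realType) (q : nat) : omega R q * (omega R q)^* = 1.
Proof.
rewrite /omega; set t := _ / _; apply/eqP; rewrite eq_complex /=.
rewrite -(cos2Dsin2 t); apply/andP; split; apply/eqP; ring.
Qed.

Lemma sign_fun_unit (R : realType) (q n : nat) (f : 'rV['F_2]_n -> 'Z_q) x :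
  sign_fun R f x * (sign_fun R f x)^* = 1.
Proof. by rewrite /sign_fun rmorphXn -exprMn omega_unit expr1n. Qed.

(** * Splitting sums over F_2^n along the first two coordinates *)

Section Prepend.

Variable n : nat.
Hypothesis n2 : (2 <= n)%N.
Implicit Types (a b : 'F_2) (z : 'rV['F_2]_(n - 2)).

Let i0 : 'I_n := Ordinal (ltnW n2).
Let i1 : 'I_n := Ordinal n2.

Lemma prepend2_0 a b z : prepend2 a b z 0 i0 = a.
Proof. by rewrite mxE. Qed.

Lemma prepend2_1 a b z : prepend2 a b z 0 i1 = b.
Proof. by rewrite mxE. Qed.

Lemma prepend2_tail a b z (j : 'I_(n - 2)) (k : 'I_n) :
  k = j.+2 :> nat -> prepend2 a b z 0 k = z 0 j.
Proof.
(* Here [j] doubles as the default element that [nth_map] requires. *)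
by move=> kj; rewrite mxE kj /= (nth_map j) ?size_enum_ord // nth_ord_enum.
Qed.

(** The coordinates recover [a], [b] and [z], which gives injectivity; the count 2 * 2 * 2^(n-2) =
    2^n does the rest. *)
Lemma prepend2_bij :
  bijective (fun p : 'F_2 * 'F_2 * 'rV['F_2]_(n - 2) =>
               prepend2 p.1.1 p.1.2 p.2 : 'rV['F_2]_n).
Proof.
apply: inj_card_bij => [[[a b] z] [[a' b'] z'] /= E|].
  have -> : a = a' by rewrite -(prepend2_0 a b z) E prepend2_0.
  have -> : b = b' by rewrite -(prepend2_1 a b z) E prepend2_1.
  congr (_, _); apply/rowP => j.
  have jn : (j.+2 < n)%N by have := ltn_ord j; rewrite ltn_subRL add2n.
  by rewrite -(@prepend2_tail a b z j (Ordinal jn)) // E (@prepend2_tail _ _ _ j).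
have c2 : #|'F_2| = 2 by rewrite card_ord.
by rewrite !card_prod !card_mx c2 !mul1n -mulnA -!expnS -[(n - 2).+2]addn2 subnK.
Qed.

Lemma prepend2_delta0 b z :
  prepend2 0 b z + delta_mx 0 i0 = prepend2 1 b z.
Proof.
by apply/rowP => -[[|k] kn]; rewrite !mxE //= ?add0r ?addr0.
Qed.

Lemma prepend2_delta1 a z :
  prepend2 a 0 z + delta_mx 0 i1 = prepend2 a 1 z.
Proof.
by apply/rowP => -[[|[|k]] kn]; rewrite !mxE //= ?add0r ?addr0.
Qed.

Lemma big_F2 (V : nmodType) (G : 'F_2 -> V) : \sum_a G a = G 0 + G 1.
Proof.
by rewrite 2!big_ord_recl big_ord0 addr0; congr (G _ + G _); apply/val_inj.
Qed.

Lemma sum_prepend2 (V : nmodType) (G : 'rV['F_2]_n -> V) :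
  \sum_x G x = \sum_a \sum_b \sum_z G (prepend2 a b z).
Proof.
rewrite (reindex _ (onW_bij _ prepend2_bij)) /=.
by rewrite -(pair_bigA _ (fun p z => G (prepend2 p.1 p.2 z))) /=
  -(pair_bigA _ (fun a b => \sum_z G (prepend2 a b z))).
Qed.

Lemma sum_prepend2_0 (V : nmodType) (G : 'rV['F_2]_n -> V) :
  \sum_(x | dotF2 (delta_mx 0 i0) x == 0) G x =
  \sum_z G (prepend2 0 0 z) + \sum_z G (prepend2 0 1 z).
Proof.
rewrite big_mkcond sum_prepend2 !big_F2.
have E0 b : \sum_z (if dotF2 (delta_mx 0 i0) (prepend2 0 b z) == 0
    then G (prepend2 0 b z) else 0) = \sum_z G (prepend2 0 b z).
  by apply: eq_bigr => z _; rewrite dotF2_delta prepend2_0.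
have E1 b : \sum_z (if dotF2 (delta_mx 0 i0) (prepend2 1 b z) == 0
    then G (prepend2 1 b z) else 0) = 0.
  by apply: big1 => z _; rewrite dotF2_delta prepend2_0.
by rewrite !E0 !E1 !addr0.
Qed.

Lemma sum_prepend2_1 (V : nmodType) (G : 'rV['F_2]_n -> V) :
  \sum_(x | dotF2 (delta_mx 0 i1) x == 0) G x =
  \sum_z G (prepend2 0 0 z) + \sum_z G (prepend2 1 0 z).
Proof.
rewrite big_mkcond sum_prepend2 !big_F2.
have E0 a : \sum_z (if dotF2 (delta_mx 0 i1) (prepend2 a 0 z) == 0
    then G (prepend2 a 0 z) else 0) = \sum_z G (prepend2 a 0 z).
  by apply: eq_bigr => z _; rewrite dotF2_delta prepend2_1.
have E1 a : \sum_z (if dotF2 (delta_mx 0 i1) (prepend2 a 1 z) == 0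
    then G (prepend2 a 1 z) else 0) = 0.
  by apply: big1 => z _; rewrite dotF2_delta prepend2_1.
by rewrite !E0 !E1 !addr0.
Qed.

End Prepend.

(** Reindexing along the bijection [e] shows that the inner product does not depend on the
    ordering. *)
Lemma dotmx_sign_block (R : realType) (q n : nat) (f : 'rV['F_2]_n -> 'Z_q)
  (e : 'I_(2 ^ (n - 2)) -> 'rV['F_2]_(n - 2)) (he : bijective e) a b a' b' :
  dotmx (sign_block R f e a b) (sign_block R f e a' b') =
  \sum_z sign_fun R f (prepend2 a b z) * (sign_fun R f (prepend2 a' b' z))^*.
Proof.
rewrite dotmxE mxE (reindex e (onW_bij _ he)).
by apply: eq_bigr => j _; rewrite !mxE.
Qed.

Theorem theorem4 (R : realType) (q n : nat)
  (hq : (2 <= q)%N) (hq_even : ~~ odd q) (hn : (4 <= n)%N)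
  (f : 'rV['F_2]_n -> 'Z_q) (hf : self_dual_gbent R f)
  (e : 'I_(2 ^ (n - 2)) -> 'rV['F_2]_(n - 2)) (he : bijective e) :
  let F := sign_block R f e in
  dotmx (F 0 0) (F 0 1) + dotmx (F 1 0) (F 1 1) = 0 /\
  dotmx (F 0 0) (F 1 0) + dotmx (F 0 1) (F 1 1) = 0.
Proof.
move=> F; have n2 : (2 <= n)%N by apply: leq_trans hn.
have c0 : (powR 2 (n%:R / 2) : R)%:C%C != 0.
  by rewrite eq_complex /= eqxx andbT gt_eqF // powR_gt0.
have c_real : ((powR 2 (n%:R / 2) : R)%:C%C)^* = (powR 2 (n%:R / 2) : R)%:C%C.
  exact: conjc_real.
have delta1 (i : 'I_n) : dotF2 (delta_mx 0 i) (delta_mx 0 i) = 1.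
  by rewrite dotF2_delta mxE !eqxx.
(* The hypothesis [hf] serves as the eigenvector equation, since [walsh] unfolds to the local
   transform [W]. *)
have half i := half_autocorrelation_eq0 c0 c_real (@sign_fun_unit R q n f)
  hf (delta1 i).
rewrite !dotmx_sign_block //; split.
  (* Translation along the second coordinate pairs block 00 with 01 and 10 with 11; the first
     coordinate handles the other identity. *)
  rewrite -[RHS](half (Ordinal n2)) sum_prepend2_1.
  by congr (_ + _); apply: eq_bigr => z _; rewrite prepend2_delta1.
rewrite -[RHS](half (Ordinal (ltnW n2))) sum_prepend2_0.
by congr (_ + _); apply: eq_bigr => z _; rewrite prepend2_delta0.
Qed.
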